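(* Let $\mathfrak{e}\subset\mathbb{R}$ be a compact set that is not finite, and for each $m\ge 1$ let $t_m = \|T_m\|_{\mathfrak{e}}$, where $T_m$ is the degree $m$ Chebyshev polynomial of $\mathfrak{e}$. Let $n\ge 1$. If $t_n = 2C(\mathfrak{e})^n$, then $t_{nk} = 2C(\mathfrak{e})^{nk}$ for all $k=1,2,\dots$.
   Context: For a compact, not finite set $\mathfrak{e}\subset\mathbb{C}$ and a continuous function $f$ on $\mathfrak{e}$, $\|f\|_{\mathfrak{e}} = \sup_{z\in\mathfrak{e}}|f(z)|$. The Chebyshev polynomial $T_m$ of $\mathfrak{e}$ is the unique monic polynomial of degree $m$ minimizing $\|P\|_{\mathfrak{e}}$ over all monic polynomials $P$ of degree $m$. $C(\mathfrak{e})$ denotes the logarithmic capacity of $\mathfrak{e}$. *)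

(* Defs.v *)
From mathcomp Require Import all_boot all_order all_algebra.
From mathcomp Require Import complex.
From mathcomp Require Import all_classical all_reals all_analysis.
Import Order.TTheory GRing.Theory Num.Theory.
Import numFieldNormedType.Exports.

Set Implicit Arguments.
Unset Strict Implicit.
Unset Printing Implicit Defensive.

Local Open Scope classical_set_scope.
Local Open Scope ring_scope.
Local Open Scope complex_scope.

(* For the real sets e considered here, a complex polynomial is evaluated on
   the image of e under the embedding x |-> x%:C of the line in the plane. *)
Definition poly_norm (R : realType) (e : set R) (P : {poly R[i]}) : R :=
  sup [set complex.Re `|P.[x%:C]| | x in e].

Definition monic_deg (R : realType) (m : nat) (P : {poly R[i]}) : Prop :=
  P \is monic /\ size P = m.+1.

Definition is_chebyshev (R : realType) (e : set R) (m : nat)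
    (P : {poly R[i]}) : Prop :=
  monic_deg m P /\
  forall Q : {poly R[i]}, monic_deg m Q -> poly_norm e P <= poly_norm e Q.

(* When e is compact and infinite, exactly one polynomial satisfies
   is_chebyshev e m, so the default value 0 is not used and the choice made by
   xget is forced. *)
Definition chebyshev_poly (R : realType) (e : set R) (m : nat) : {poly R[i]} :=
  xget 0 [set P : {poly R[i]} | is_chebyshev e m P].

(* lne 0 = -oo, so the kernel log (1 / |x - y|) is +oo on the diagonal. *)
Definition log_energy (R : realType) (e : set R)
    (mu : probability (measurableTypeR R) R) : \bar R :=
  (\int[mu]_(x in e) \int[mu]_(y in e) (- lne `|x - y|%:E))%E.

(* A Borel probability measure on C carried by e, for e in the real line, is a
   Borel probability measure on R giving mass 1 to e.  With expeR -oo = 0, a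
   set on which all energies are infinite has capacity 0. *)
Definition log_capacity (R : realType) (e : set R) : R :=
  fine (expeR (- ereal_inf [set log_energy e mu |
    mu in [set mu : probability (measurableTypeR R) R | mu e = 1%E]])%E).

(* Main.v *)
(* The bound t_m >= 2 C(e)^m (Schiefermayer) holds for every compact e in R, so
   only t_(nk) <= 2 C(e)^(nk) uses the hypothesis; it is witnessed by
   D_k(Re T_n), where D_k (dickson below) is the monic Chebyshev polynomial of
   the interval [-t_n, t_n], whose norm there is 2 (t_n / 2)^k.

   For the lower bound no equilibrium measure is needed.  Let |P| <= 2 s on e
   with P real, monic of degree N.  A measure of energy at most a yields, by the
   method of conditional expectations, m points of e whose Vandermonde
   determinant is at least exp(- 'C(m, 2) a).  Computing that determinant in the
   basis D_(k / N)(P) X^(k mod N) bounds it by m! A^m s^(m^2 / 2N + O(m)), and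
   m -> oo gives exp(-a)^N <= s. *)
Require Import Defs.
From mathcomp Require Import all_boot all_order all_algebra.
From mathcomp Require Import complex ring lra zify.
From mathcomp Require Import all_classical all_reals all_analysis.
From mathcomp Require Import perm measurable_realfun.
Import Order.TTheory GRing.Theory Num.Theory.
Import numFieldNormedType.Exports.
Local Open Scope classical_set_scope.
Local Open Scope ring_scope.

(** * Chebyshev polynomials of an interval composed with P *)

(** The Dickson polynomial of the first kind at [P]. For [a = s^2] with [s != 0] it is
    [2 s^k T_k(P / (2 s))], where [T_k] is the classical Chebyshev polynomial. *)
Fixpoint dickson {R : realType} (a : R) (P : {poly R}) (k : nat) : {poly R} :=
  if k is k1.+1 then
    if k1 is k2.+1 then P * dickson a P k1 - a *: dickson a P k2 else P
  else 2%:R%:P.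

(** The recurrence mirrors [cos((k+2) t) + cos(k t) = 2 cos t cos((k+1) t)], so the induction
    carries two consecutive indices. *)
Lemma dickson_cos {R : realType} (s : R) (P : {poly R}) (x t : R) (k : nat) :
  P.[x] = 2 * s * cos t ->
  (dickson (s ^+ 2) P k).[x] = 2 * s ^+ k * cos (k%:R * t).
Proof.
move=> Px.
suff [] : (dickson (s ^+ 2) P k).[x] = 2 * s ^+ k * cos (k%:R * t) /\
  (dickson (s ^+ 2) P k.+1).[x] = 2 * s ^+ k.+1 * cos (k.+1%:R * t) by [].
elim: k => [|k [IH0 IH1]].
  by rewrite /= hornerC mul0r cos0 expr0 expr1 mul1r !mulr1.
split=> //; rewrite [dickson _ _ k.+2]/= -/(dickson (s ^+ 2) P k.+1).
rewrite hornerD hornerN hornerM hornerZ IH0 IH1 Px.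
have -> : k.+2%:R * t = k.+1%:R * t + t by rewrite -natr1 mulrDl mul1r.
have -> : k%:R * t = k.+1%:R * t - t by rewrite -natr1 mulrDl mul1r addrK.
rewrite cosB cosD !exprS expr0; ring.
Qed.

Lemma dickson_norm_le {R : realType} (s : R) (P : {poly R}) (x : R) (k : nat) :
  0 <= s -> `|P.[x]| <= 2 * s -> `|(dickson (s ^+ 2) P k).[x]| <= 2 * s ^+ k.
Proof.
move=> s0 Px.
have Py : P.[x] = 2 * s * cos (acos (P.[x] / (2 * s))).
  (* For [s = 0] the hypothesis forces [P.[x] = 0], and any angle would do. *)
  have [sE|sN0] := eqVneq s 0.
    by move: Px; rewrite sE mulr0 normr_le0 mul0r => /eqP.
  have s20 : 0 < 2 * s by rewrite mulr_gt0 // lt_def sN0.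
  rewrite acosK; last first.
    by rewrite in_itv /= -ler_norml normrM normfV (gtr0_norm s20) ler_pdivrMr ?mul1r.
  by rewrite mulrC divfK ?gt_eqF.
rewrite (dickson_cos _ _ _ _ k Py) normrM.
have c0 : 0 <= 2 * s ^+ k by rewrite mulr_ge0 // exprn_ge0.
rewrite (ger0_norm c0) -[leRHS]mulr1 ler_wpM2l //.
by rewrite ler_norml cos_geN1 cos_le1.
Qed.

Lemma dickson_monic_size {R : realType} (a : R) (P : {poly R}) (n k : nat) :
  P \is monic -> size P = n.+1 -> (0 < n)%N -> (0 < k)%N ->
  dickson a P k \is monic /\ size (dickson a P k) = (n * k).+1.
Proof.
move=> mP sP n0; case: k => // k _.
suff [] : [/\ dickson a P k.+1 \is monic,
  size (dickson a P k.+1) = (n * k.+1).+1 &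
  (size (dickson a P k) <= (n * k).+1)%N] by [].
elim: k => [|k [IH1 IH2 IH3]].
  by rewrite muln1 muln0 /= size_polyC; split=> //; case: eqP.
have mM : P * dickson a P k.+1 \is monic by rewrite monicMl.
have sM : size (P * dickson a P k.+1) = (n * k.+2).+1.
  rewrite size_proper_mul; last by rewrite (monicP mP) (monicP IH1) mulr1 oner_eq0.
  rewrite sP IH2 mulnS; lia.
have ltM : (size (- (a *: dickson a P k))%R < size (P * dickson a P k.+1)%R)%N.
  rewrite size_polyN sM; apply: leq_ltn_trans (size_scale_leq _ _) _.
  apply: leq_ltn_trans IH3 _; rewrite ltnS; nia.
rewrite [dickson _ _ k.+2]/= -/(dickson a P k.+1).
split; last by rewrite IH2.
  by rewrite monicE lead_coefDl // -monicE.
by rewrite size_polyDl.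
Qed.

(** * Vandermonde determinants in a basis of monic polynomials *)

(** Leibniz's expansion. The crude factor [m!] is harmless: its logarithm is [O(m ln m)], against
    main terms of order [m^2]. *)
Lemma normr_det_le {R : realType} (m : nat) (A : 'M[R]_m) (B : 'I_m -> R) :
  (forall i j, `|A i j| <= B i) -> `|\det A| <= m`!%:R * \prod_i B i.
Proof.
move=> AB; rewrite /determinant; apply: le_trans (ler_norm_sum _ _ _) _.
apply: (@le_trans _ _ (\sum_(s : {perm 'I_m}) \prod_i B i)).
  apply: ler_sum => s _; rewrite normrM normrX normrN1 expr1n mul1r normr_prod.
  by apply: ler_prod => i _; rewrite normr_ge0 AB.
by rewrite sumr_const card_Sn mulr_natl.
Qed.

(* The coefficient matrix of monic p_k of degree k is unitriangular, so the p_k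
   have the same Vandermonde determinant as the monomials. *)
Lemma vandermonde_monic_le {R : realType} (m : nat) (x : 'I_m -> R)
    (p : nat -> {poly R}) (B : nat -> R) :
  (forall k, p k \is monic /\ size (p k) = k.+1) ->
  (forall (k : 'I_m) (i : 'I_m), `|(p k).[x i]| <= B k) ->
  \prod_(i < m) \prod_(j < m | (i < j)%N) `|x j - x i| <= m`!%:R * \prod_(k < m) B k.
Proof.
move=> mp pB.
pose L : 'M[R]_m := \matrix_(k, l) (p k)`_l.
have detL : \det L = 1.
  rewrite det_trig; last first.
    apply/is_trig_mxP => k l kl; rewrite mxE nth_default //.
    by case: (mp k) => _ ->.
  rewrite big1 // => k _; rewrite mxE; case: (mp k) => /monicP + sk.
  by rewrite /lead_coef sk.
have dV := det_mulmx L (Vandermonde m (\row_i x i)).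
rewrite detL mul1r det_Vandermonde in dV.
apply: (le_trans _ (normr_det_le m (L *m Vandermonde m (\row_i x i))
  (fun k => B k) _)); last first.
  move=> k i; rewrite mxE; apply: (le_trans _ (pB k i)).
  rewrite (@horner_coef_wide _ m); last by case: (mp k) => _ ->.
  rewrite le_eqVlt; apply/orP; left; apply/eqP; congr `|_|.
  by apply: eq_bigr => l _; rewrite !mxE.
rewrite dV normr_prod; apply: ler_prod => i _; rewrite prodr_ge0 //= normr_prod.
by apply: ler_prod => j _; rewrite !mxE normr_ge0 lexx.
Qed.

(** * Sampling points from a measure of finite energy *)

(** The integral of [f] may be [+oo], so linearity for integrable functions does not apply. But the
    negative part is at most [c], hence of finite integral, and once it is added to both sides all
    terms are nonnegative. *)
Lemma integral_shift {d : measure_display} {T : measurableType d} {R : realType}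
    (mu : probability T R) (e : set T) (f : T -> \bar R) (c : R) :
  measurable e -> mu e = 1%E -> measurable_fun e f -> 0 <= c ->
  (forall x, e x -> (0 <= f x + c%:E)%E) ->
  (\int[mu]_(x in e) (f x + c%:E) = \int[mu]_(x in e) f x + c%:E)%E.
Proof.
move=> me mue mf c0 fc.
have fNle x : e x -> (f^\- x <= c%:E)%E.
  move=> ex; rewrite funenegE ge_max lee_fin c0 andbT.
  have := fc x ex; case: (f x) => [r| |] //=; last by rewrite leNye.
  by rewrite -?EFinD !lee_fin; lra.
have mfp := measurable_funepos mf; have mfn := measurable_funeneg mf.
have intc : (\int[mu]_(x in e) c%:E = c%:E)%E.
  by rewrite integral_cst // -[RHS]mule1; congr (_ * _)%E; exact: mue.
have intN : (\int[mu]_(x in e) f^\- x)%E \is a fin_num.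
  rewrite ge0_fin_numE ?integral_ge0 //.
  apply: (@le_lt_trans _ _ (\int[mu]_(x in e) c%:E)%E); last by rewrite intc ltry.
  exact: ge0_le_integral.
have key : (\int[mu]_(x in e) (f x + c%:E) + \int[mu]_(x in e) f^\- x
   = \int[mu]_(x in e) f^\+ x + c%:E)%E.
  rewrite -[X in (_ = _ + X)%E]intc -ge0_integralD //; last 1 first.
    by apply: emeasurable_funD => //; exact: measurable_cst.
  rewrite -ge0_integralD //.
  apply: eq_integral => x /[!inE] ex.
  have fn : (f^\- x)%E \is a fin_num.
    by rewrite ge0_fin_numE //; apply: le_lt_trans (fNle x ex) (ltry c).
  have -> : f x = (f^\+ x - f^\- x)%E by rewrite {1}(funeposneg f).
  by rewrite addeAC subeK.
rewrite [in RHS]integralE addeAC -key addeK //.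
Qed.

(** If [f > a] throughout [e], then [f - a] is positive on [e] with integral zero, so [e] would be a
    null set. *)
Lemma exists_le_integral {d : measure_display} {T : measurableType d} {R : realType}
    (mu : probability T R) (e : set T) (f : T -> \bar R) (a : R) :
  measurable e -> mu e = 1%E -> measurable_fun e f ->
  (forall x, e x -> (0 <= f x)%E) ->
  (\int[mu]_(x in e) f x <= a%:E)%E -> exists2 x, e x & (f x <= a%:E)%E.
Proof.
move=> me mue mf f0 fa; apply: contrapT => H.
have lt x : e x -> (a%:E < f x)%E.
  by move=> ex; rewrite ltNge; apply/negP => fx; apply: H; exists x.
have a0 : 0 <= a by rewrite -lee_fin; apply: le_trans fa; exact: integral_ge0.
pose g x := (f x + (- a)%:E)%E.
have g0 x : e x -> (0 < g x)%E by move=> ex; rewrite /g EFinN sube_gt0 lt.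
have mg : measurable_fun e g by apply: emeasurable_funD => //; exact: measurable_cst.
have fE : (\int[mu]_(x in e) f x = \int[mu]_(x in e) g x + a%:E)%E.
  rewrite -integral_shift //.
    by apply: eq_integral => x _; rewrite /g EFinN subeK.
  by move=> x ex; rewrite adde_ge0 // ltW // g0.
have : (\int[mu]_(x in e) `|g x| = 0)%E.
  apply/eqP; rewrite eq_le integral_ge0 // andbT.
  under eq_integral => x /[!inE] ex do rewrite gee0_abs ?ltW ?g0 //.
  by rewrite -(@leeD2rE _ a%:E) // -fE add0e.
move/(ae_eq_integral_abs mu me mg) => [N [mN muN sN]].
have : (mu e <= mu N)%E.
  apply: le_measure; rewrite ?inE // => x ex; apply: sN => /= /(_ ex) g0E.
  by have := g0 x ex; rewrite g0E ltxx.
by rewrite mue muN lee_fin ler10.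
Qed.

Lemma energy_sample {d : measure_display} {T : measurableType d} {R : realType}
    (mu : probability T R) (e : set T) (K : T -> T -> \bar R) (a : R) (m : nat) :
  measurable e -> mu e = 1%E -> measurable_fun setT (fun z => K z.1 z.2) ->
  (forall x y, (0 <= K x y)%E) -> (\int[mu]_x \int[mu]_y K x y <= a%:E)%E ->
  exists s : nat -> T, (forall i, (i < m)%N -> e (s i)) /\
    (\sum_(i < m) \sum_(j < i) K (s j) (s i) <= ('C(m, 2)%:R * a)%:E)%E.
Proof.
move=> me mue mK K0 Ka.
(* [U x] is the expected kernel between a fixed point [x] and a random later one. *)
pose U x := (\int[mu]_y K x y)%E.
have U0 x : (0 <= U x)%E by exact: integral_ge0.
have mU : measurable_fun setT U.
  exact: (measurable_fun_fubini_tonelli_F (m2 := mu) (fun z => K z.1 z.2) mK).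
have mKx x : measurable_fun setT (K x).
  exact: (measurableT_comp mK (pair1_measurable x)).
(* The left-hand side is the expected sum over all pairs when the first j points
   are fixed and the others are independent of law mu; some choice of the next
   point does not increase it. *)
suff main (j : nat) : (j <= m)%N -> exists s : nat -> T,
    (forall i, (i < j)%N -> e (s i)) /\
    (\sum_(i < j) \sum_(l < i) K (s l) (s i) +
      ((m - j)%:R%:E * \sum_(i < j) U (s i) + ('C(m - j, 2)%:R * a)%:E)
     <= ('C(m, 2)%:R * a)%:E)%E.
  have [s [es]] := main m (leqnn m).
  by rewrite subnn mul0e add0e bin0n mul0r adde0; exists s.
elim: j => [_|j IH jm].
  (* Applied to the zero function, the lemma merely provides a point of [e]. *)
  have [x ex _] : exists2 x, e x & (0 <= 0%:E :> \bar R)%E.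
    apply: (@exists_le_integral _ _ _ mu e (cst 0%E) 0) => //.
    by rewrite integral0.
  by exists (fun=> x); split=> //; rewrite !big_ord0 subn0 mule0 !add0e.
have [s [es le]] := IH (ltnW jm).
set A := (\sum_(i < j) _)%E in le; set B := (\sum_(i < j) U _)%E in le.
have A0 : (0 <= A)%E by rewrite /A; do 2! apply: sume_ge0 => ? _.
have B0 : (0 <= B)%E by rewrite /B; apply: sume_ge0 => ? _.
have a0 : 0 <= a.
  by rewrite -lee_fin; apply: le_trans Ka; apply: integral_ge0 => x _; exact: U0.
set k := (m - j.+1)%N; have mjk : (m - j)%N = k.+1 by rewrite /k; lia.
rewrite mjk in le.
have kB0 : (0 <= k.+1%:R%:E * B)%E by rewrite mule_ge0 ?lee_fin.
have ca0 n : (0 <= ('C(n, 2)%:R * a)%:E)%E by rewrite lee_fin mulr_ge0.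
(* Finiteness of [A] and [B] reduces the comparison of expectations to real arithmetic. *)
have Afin : A \is a fin_num.
  rewrite ge0_fin_numE //; apply: le_lt_trans (ltry ('C(m, 2)%:R * a)).
  by apply: le_trans le; rewrite leeDl // adde_ge0.
have Bfin : B \is a fin_num.
  rewrite ge0_fin_numE //; apply: le_lt_trans (ltry ('C(m, 2)%:R * a)).
  apply: (@le_trans _ _ (k.+1%:R%:E * B)%E).
    by rewrite -[leLHS]mul1e lee_wpmul2r // lee_fin ler1n.
  apply: le_trans le; rewrite addeA addeAC leeDr //.
  by rewrite adde_ge0.
(* The conditional expectation when the next point is [y]: pairs of [y] with earlier points, of [y]
   with the [k] later ones, and all pairs without [y]. Its mean is at most the previous bound, by
   Pascal's rule and since [U] has mean at most [a]. *)
pose f y := (\sum_(l < j) K (s l) y + (k%:R%:E * U y +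
   (A + (k%:R%:E * B + ('C(k, 2)%:R * a)%:E))))%E.
have c0 : (0 <= A + (k%:R%:E * B + ('C(k, 2)%:R * a)%:E))%E.
  by apply: adde_ge0 => //; apply: adde_ge0; rewrite ?mule_ge0 ?lee_fin ?mulr_ge0.
have mf1 : measurable_fun setT (fun y => \sum_(l < j) K (s l) y)%E.
  exact: emeasurable_sum.
have f10 y : (0 <= \sum_(l < j) K (s l) y)%E by apply: sume_ge0.
have mf2 : measurable_fun setT (fun y => k%:R%:E * U y)%E.
  by apply: measurable_funeM.
have f20 y : (0 <= k%:R%:E * U y)%E by rewrite mule_ge0 ?lee_fin.
have f0 y : (0 <= f y)%E by apply: adde_ge0 => //; exact: adde_ge0.
have mf : measurable_fun setT f.
  by do 2! apply: emeasurable_funD => //.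
have [y ey fy] : exists2 y, e y & (f y <= ('C(m, 2)%:R * a)%:E)%E.
  apply: (@exists_le_integral _ _ _ mu e f) => //; first exact: measurable_funTS.
  apply: (@le_trans _ _ (\int[mu]_y f y)%E); first exact: ge0_subset_integral.
  apply: le_trans le; rewrite /f ge0_integralD //; last 2 first.
    by move=> y _; rewrite adde_ge0.
    by apply: emeasurable_funD.
  rewrite ge0_integral_sum // -/B ge0_integralD // ge0_integralZl_EFin //.
  rewrite [X in (_ + (_ + X) <= _)%E](_ : _ =
      A + (k%:R%:E * B + ('C(k, 2)%:R * a)%:E))%E; last first.
    rewrite integral_cst // -[RHS]mule1; congr (_ * _)%E.
    exact: probability_setT.
  have IUfin : (\int[mu]_x U x)%E \is a fin_num.
    by rewrite ge0_fin_numE ?integral_ge0 //; apply: le_lt_trans Ka (ltry a).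
  move: Ka; rewrite -/U.
  rewrite -(fineK Afin) -(fineK Bfin) -(fineK IUfin).
  rewrite -!(EFinM, EFinD) !lee_fin => IUa.
  rewrite binS bin1 natrD -natr1.
  have : 0 <= k%:R * (a - fine (\int[mu]_x U x)%E) by rewrite mulr_ge0 // subr_ge0.
  rewrite mulrBr mulrDl; lra.
exists (fun i => if i == j then y else s i); split.
  by move=> i; rewrite ltnS leq_eqVlt; case: eqP => //= _; exact: es.
apply: le_trans fy; rewrite /f.
rewrite !big_ord_recr /= eqxx.
under eq_bigr => i _ do (under eq_bigr => l _ do rewrite
  (ltn_eqF (ltn_trans (ltn_ord l) (ltn_ord i))) (ltn_eqF (ltn_ord i))).
under [X in (_ + X + _)%E]eq_bigr => l _ do rewrite (ltn_eqF (ltn_ord l)).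
under [X in (_ * (X + _))%E]eq_bigr => l _ do rewrite (ltn_eqF (ltn_ord l)).
rewrite -/A -/B ge0_muleDr // -!addeA.
rewrite [X in (_ <= _ + X)%E]addeCA [leRHS]addeCA.
by rewrite [X in (_ <= _ + (_ + X))%E]addeCA.
Qed.

(** * The logarithmic kernel *)

Lemma measurable_lne (R : realType) : measurable_fun setT (fun r : R => lne r%:E).
Proof.
rewrite (_ : (fun r : R => _) = (fun r => if r <= 0 then -oo%E else (ln r)%:E)).
  apply: measurable_fun_ifT => //.
    exact: measurable_fun_ler.
  by apply/measurable_EFinP; exact: measurable_ln.
apply/funext => r; case: (leP r 0) => r0; first by rewrite le0_lneNy ?lee_fin.
by rewrite lne_EFin.
Qed.

Definition log_kernel {R : realType} (x y : R) : \bar R := (- lne `|x - y|%:E)%E.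

Lemma measurable_log_kernel (R : realType) :
  measurable_fun setT (fun z : measurableTypeR R * measurableTypeR R => log_kernel z.1 z.2).
Proof.
apply: measurableT_comp => //.
apply: (measurableT_comp (measurable_lne R)).
apply: measurableT_comp => //.
by apply: measurable_funB.
Qed.

Lemma compact_normr_le {R : realType} (e : set R) :
  compact e -> exists2 D : R, 1 <= D & forall x, e x -> `|x| <= D.
Proof.
move=> /compact_bounded [M [_ HM]].
exists (Num.max 1 (M + 1)); first by rewrite le_max lexx.
by move=> x ex; apply: HM => //; rewrite lt_max ltrDl ltr01 orbT.
Qed.

(** Points of [[-D, D]] are at distance at most [2 D]. The shift makes the kernel nonnegative, as
    Tonelli's theorem and [energy_sample] require. *)
Lemma log_kernel_bounded {R : realType} (D x y : R) :
  1 <= D -> `|x| <= D -> `|y| <= D -> (0 <= log_kernel x y + (ln (2 * D))%:E)%E.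
Proof.
move=> D1 xD yD; rewrite /log_kernel.
have D0 : 0 < 2 * D by lra.
have [->|xy] := eqVneq `|x - y| 0; first by rewrite le0_lneNy ?lee_fin //= leey.
have xy0 : 0 < `|x - y| by rewrite lt_def xy normr_ge0.
rewrite lne_EFin // -EFinN -EFinD lee_fin addrC subr_ge0 ler_ln ?posrE //.
by apply: le_trans (ler_normB _ _) _; lra.
Qed.

Lemma measurable_shifted_kernel {R : realType} (e : set R) (c : R) : measurable e ->
  measurable_fun setT (((fun z : measurableTypeR R * measurableTypeR R =>
    log_kernel z.1 z.2 + c%:E)%E) \_ (e `*` e)).
Proof.
move=> me; apply/(measurable_restrictT _ _).1.
  exact: measurableX.
apply: measurable_funTS; apply: emeasurable_funD; first exact: measurable_log_kernel.
exact: measurable_cst.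
Qed.

(** Extension by zero gives a nonnegative kernel on the whole plane, the form taken by
    [energy_sample]. [integral_shift] is applied to the inner integral, then to the outer one. *)
Lemma integral_shifted_kernel {R : realType} (e : set R)
    (mu : probability (measurableTypeR R) R) (c : R) :
  measurable e -> mu e = 1%E -> 0 <= c ->
  (forall x y, e x -> e y -> (0 <= log_kernel x y + c%:E)%E) ->
  (\int[mu]_x \int[mu]_y
     ((fun z : R * R => log_kernel z.1 z.2 + c%:E) \_ (e `*` e)) (x, y) =
   log_energy e mu + c%:E)%E.
Proof.
move=> me mue c0 k0; set K := (_ \_ _).
have KE x : (\int[mu]_y K (x, y) =
    ((fun x => \int[mu]_(y in e) (log_kernel x y + c%:E)) \_ e) x)%E.
  rewrite /patch; case: ifPn => xe.
    rewrite [RHS]integral_mkcond; apply: eq_integral => y _.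
    by rewrite /K /patch in_setX /= xe.
  apply: integral0_eq => y _.
  by rewrite /K /patch in_setX /= (negbTE xe).
have mk x : measurable_fun e (log_kernel x).
  apply: measurable_funTS.
  exact: (measurableT_comp (measurable_log_kernel R) (pair1_measurable x)).
have UE x : e x -> (\int[mu]_(y in e) (log_kernel x y + c%:E) =
    \int[mu]_(y in e) log_kernel x y + c%:E)%E.
  move=> ex; apply: integral_shift; [exact: me|exact: mue|exact: mk|exact: c0|].
  by move=> y ey; exact: k0.
have K0 z : (0 <= K z)%E.
  by rewrite /K /patch; case: ifPn => // /[!inE] -[? ?]; exact: k0.
have mU : measurable_fun setT (fun x => \int[mu]_y K (x, y))%E.
  by apply: (measurable_fun_fubini_tonelli_F (m2 := mu) K
    (measurable_shifted_kernel e c me)).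
under eq_integral => x _ do rewrite KE.
rewrite -integral_mkcond.
under eq_integral => x /[!inE] ex do rewrite UE //.
rewrite integral_shift //.
  apply: (@eq_measurable_fun _ _ _ _ e
      (fun x => \int[mu]_y K (x, y) + (- c)%:E)%E).
    move=> x /[!inE] ex; rewrite KE /patch mem_set // UE //.
    by rewrite EFinN addeK.
  apply: emeasurable_funD; last exact: measurable_cst.
  exact: measurable_funTS.
by move=> x ex; rewrite -UE //; apply: integral_ge0 => y ey; exact: k0.
Qed.

(** Turns energies into products of distances; a term [+oo] becomes a factor 0. *)
Lemma expeRN_sum {R : realType} (I : Type) (r : seq I) (F : I -> \bar R) (g : I -> R) :
  (forall i, (0 <= F i)%E) -> (forall i, expeR (- F i)%E = (g i)%:E) ->
  expeR (- (\sum_(i <- r) F i)%R)%E = (\prod_(i <- r) g i)%:E.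
Proof.
move=> F0 Fg; elim: r => [|i r IH]; first by rewrite !big_nil oppe0 expeR0.
rewrite !big_cons oppeD ?ge0_adde_def ?inE ?F0 ?sume_ge0 //.
by rewrite expeRD Fg IH EFinM.
Qed.

Lemma expeRN_log_kernel {R : realType} (x y : R) :
  expeR (- log_kernel x y)%E = `|x - y|%:E.
Proof. by rewrite /log_kernel oppeK lneK // in_itv /= lee_fin normr_ge0 leey. Qed.

Lemma prod_pairs_swap {R : realType} (m : nat) (F : nat -> nat -> R) :
  \prod_(i < m) \prod_(l < i) F l i = \prod_(i < m) \prod_(j < m | (i < j)%N) F i j.
Proof.
rewrite [RHS](exchange_big_dep predT) //=; apply: eq_bigr => i _.
by rewrite (big_ord_widen _ (fun l => F l i) (ltnW (ltn_ord i))).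
Qed.

(** The exponential of the inequality of [energy_sample]. The shift [c] contributes [exp(-c)] once
    per pair on both sides and cancels. *)
Lemma energy_vandermonde {R : realType} (e : set R)
    (mu : probability (measurableTypeR R) R) (a : R) (m : nat) :
  compact e -> mu e = 1%E -> (log_energy e mu <= a%:E)%E ->
  exists2 x : nat -> R, (forall i, (i < m)%N -> e (x i)) &
    expR (- ('C(m, 2)%:R * a)) <=
      \prod_(i < m) \prod_(j < m | (i < j)%N) `|x j - x i|.
Proof.
move=> ce mue Ea; have me := compact_measurable ce.
have [D D1 eD] := compact_normr_le e ce.
pose c := ln (2 * D).
have c0 : 0 <= c by rewrite ln_ge0 //; lra.
have k0 x y : e x -> e y -> (0 <= log_kernel x y + c%:E)%E.
  by move=> ex ey; apply: log_kernel_bounded; rewrite ?eD.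
pose K x y := ((fun z : R * R => log_kernel z.1 z.2 + c%:E)%E \_ (e `*` e)) (x, y).
have K0 x y : (0 <= K x y)%E.
  by rewrite /K /patch; case: ifPn => // /[!inE] -[? ?]; exact: k0.
have mK : measurable_fun setT (fun z : measurableTypeR R * measurableTypeR R => K z.1 z.2).
  rewrite (_ : (fun z => _) =
    ((fun z : R * R => log_kernel z.1 z.2 + c%:E)%E \_ (e `*` e))).
    exact: measurable_shifted_kernel.
  by apply/funext => -[].
have KI : (\int[mu]_x \int[mu]_y K x y <= (a + c)%:E)%E.
  by rewrite /K integral_shifted_kernel // EFinD leeD2r.
have [s [es]] := energy_sample mu e K (a + c) m me mue mK K0 KI.
rewrite (_ : (\sum_(i < m) _)%R =
    (\sum_(i < m) \sum_(j < i) (log_kernel (s j) (s i) + c%:E)%E)%R); last first.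
  apply: eq_bigr => i _; apply: eq_bigr => j _; rewrite /K /patch mem_set //.
  by split; apply: es => //=; exact: ltn_trans (ltn_ord j) (ltn_ord i).
move=> le; exists s => //.
move: le; rewrite -leeN2 -lee_expeR.
rewrite (expeRN_sum _ _ _ (fun i : 'I_m => \prod_(j < i) (`|s j - s i| * expR (- c)))).
- rewrite -EFinN lee_fin.
  under eq_bigr do rewrite big_split /= prodr_const card_ord.
  rewrite big_split /= -expr_sum -(big_mkord xpredT id) bin2_sum -expRM_natl.
  have -> : - ('C(m, 2)%:R * (a + c)) = - ('C(m, 2)%:R * a) + 'C(m, 2)%:R * - c by ring.
  rewrite expRD ler_pM2r ?expR_gt0 // (prod_pairs_swap m (fun l i => `|s l - s i|)).
  by under eq_bigr do under eq_bigr do rewrite distrC.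
- move=> i; apply: sume_ge0 => j _; apply: k0; apply: es => //.
  exact: ltn_trans (ltn_ord j) (ltn_ord i).
- move=> i; apply: expeRN_sum => j.
    by apply: k0; apply: es => //; exact: ltn_trans (ltn_ord j) (ltn_ord i).
  rewrite oppeD ?fin_num_adde_defl // expeRD expeRN_log_kernel.
  by rewrite -EFinN -EFinM.
Qed.

(** * The capacity bound for real polynomials *)

Lemma fact_le_exp (n : nat) : (n`! <= n ^ n)%N.
Proof.
suff H k : (k <= n -> k`! <= n ^ k)%N by exact: H.
elim: k => // k IH kn; rewrite factS expnS leq_mul //; exact/IH/ltnW.
Qed.

Lemma natr_bin2 {R : realType} (n : nat) :
  'C(n, 2)%:R * 2 = n%:R * (n%:R - 1) :> R.
Proof.
elim: n => [|n IH]; first by rewrite bin0n !mul0r.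
rewrite binS bin1 natrD mulrDl IH -natr1; ring.
Qed.

(** This is the exponent of [s] in the Vandermonde bound; each quotient below [q] occurs [N]
    times. *)
Lemma sum_divn (N q : nat) : (0 < N)%N -> (\sum_(k < N * q) k %/ N = N * 'C(q, 2))%N.
Proof.
move=> N0; elim: q => [|q IH]; first by rewrite muln0 big_ord0.
rewrite mulnS addnC big_split_ord /= IH binS bin1 mulnDr; congr addn.
under eq_bigr => i _ do rewrite mulnC divnMDl // divn_small // addn0.
by rewrite sum_nat_const card_ord.
Qed.

(* The basis D_(k / N)(P) X^(k mod N) has degree k and sup norm of order
   s^(k / N), which is what makes the Vandermonde bound asymptotically sharp. *)
Lemma vandermonde_dickson_le {R : realType} (e : set R) (P : {poly R}) (s D : R)
    (N q : nat) (x : nat -> R) :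
  P \is monic -> size P = N.+1 -> (0 < N)%N -> 0 < s -> 1 <= D ->
  (forall x, e x -> `|x| <= D) -> (forall x, e x -> `|P.[x]| <= 2 * s) ->
  (forall i, (i < N * q)%N -> e (x i)) ->
  \prod_(i < N * q) \prod_(j < N * q | (i < j)%N) `|x j - x i| <=
    (N * q)`!%:R * ((2 * D ^+ N) ^+ (N * q) * s ^+ (N * 'C(q, 2))).
Proof.
move=> mP sP N0 s0 D1 eD eP ex.
(* [dickson] at index 0 is the constant 2, which is not monic, so 1 replaces it. *)
pose p k := (if (k %/ N == 0)%N then 1 else dickson (s ^+ 2) P (k %/ N)) * 'X^(k %% N).
apply: le_trans (vandermonde_monic_le (N * q) x p
  (fun k => 2 * D ^+ N * s ^+ (k %/ N)) _ _) _.
- move=> k; rewrite /p; set Q := if _ then _ else _.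
  have [mQ sQ] : Q \is monic /\ size Q = (N * (k %/ N)).+1.
    rewrite /Q; case: eqP => [->|/eqP k0]; first by rewrite monic1 size_poly1 muln0.
    by apply: dickson_monic_size => //; rewrite lt0n.
  split; first by rewrite monicMr ?monicXn.
  rewrite size_mulXn ?monic_neq0 // sQ addnS; congr S.
  by rewrite addnC mulnC -divn_eq.
- move=> k i; have exi := ex i (ltn_ord i).
  rewrite /p hornerM hornerXn normrM normrX mulrAC.
  apply: ler_pM => //.
    case: eqP => [->|_]; last exact: dickson_norm_le (ltW s0) (eP _ exi).
    by rewrite hornerC normr1 expr0 mulr1 ler1n.
  apply: (@le_trans _ _ (D ^+ (k %% N))).
    by apply: lerXn2r; rewrite ?nnegrE ?normr_ge0 ?(le_trans ler01 D1) ?eD.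
  by rewrite ler_weXn2l // ltnW // ltn_pmod.
rewrite big_split /= prodr_const card_ord -expr_sum sum_divn //.
Qed.

(** For an energy below the bound, the lower and upper estimates of the Vandermonde product at
    [m = N q] points contradict each other for large [q]. *)
Lemma energy_lower_bound {R : realType} (e : set R) (P : {poly R}) (s : R) (N : nat)
    (mu : probability (measurableTypeR R) R) :
  compact e -> P \is monic -> size P = N.+1 -> (0 < N)%N -> 0 < s ->
  (forall x, e x -> `|P.[x]| <= 2 * s) -> mu e = 1%E ->
  ((- (ln s / N%:R))%:E <= log_energy e mu)%E.
Proof.
move=> ce mP sP N0 s0 eP mue; rewrite leNgt; apply/negP => lt.
have N0' : 0 < N%:R :> R by rewrite ltr0n.
(* The value [-oo] is not excluded here; any real below the bound then serves as [a]. *)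
have [a Ea aL] : exists2 a : R, (log_energy e mu <= a%:E)%E & a < - (ln s / N%:R).
  case: (log_energy e mu) lt => [r| |] //; first by rewrite lte_fin; exists r.
  by move=> _; exists (- (ln s / N%:R) - 1); [exact: leNye | rewrite ltrBlDr ltrDl].
pose delta := - ln s - N%:R * a.
have d0 : 0 < delta.
  by move: aL; rewrite -mulNr ltr_pdivlMr // /delta subr_gt0 mulrC.
have [D D1 eD] := compact_normr_le e ce.
pose A := 2 * D ^+ N.
have A0 : 0 < A by rewrite mulr_gt0 // exprn_gt0 // (lt_le_trans ltr01).
(* Logarithms of both estimates, with [m! <= m^m], multiplied by [2 / (N q)]. The terms linear in
   [q] are collected into [q delta]. *)
have main q : (0 < q)%N ->
    q%:R * delta <= 2 * ln N%:R + 2 * ln A - a - ln s + 2 * ln q%:R.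
  move=> q0; have q0' : 0 < q%:R :> R by rewrite ltr0n.
  pose m := (N * q)%N; have m0 : (0 < m)%N by rewrite muln_gt0 N0.
  have m0' : 0 < m%:R :> R by rewrite ltr0n.
  have [x ex le] := energy_vandermonde e mu a m ce mue Ea.
  have le1 := le_trans le
    (vandermonde_dickson_le e P s D N q x mP sP N0 s0 D1 eD eP ex).
  have X0 : 0 < A ^+ m * s ^+ (N * 'C(q, 2)) by rewrite mulr_gt0 ?exprn_gt0.
  have mm0 : 0 < (m ^ m)%:R :> R by rewrite ltr0n expn_gt0 m0.
  have : expR (- ('C(m, 2)%:R * a)) <= (m ^ m)%:R * (A ^+ m * s ^+ (N * 'C(q, 2))).
    by apply: le_trans le1 _; rewrite -/A -/m ler_pM2r // ler_nat fact_le_exp.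
  rewrite -ler_ln ?posrE ?expR_gt0 ?(mulr_gt0 mm0 X0) //.
  rewrite expRK lnM ?posrE //.
  rewrite lnM ?posrE ?(exprn_gt0 _ A0) ?(exprn_gt0 _ s0) //.
  rewrite natrX !lnXn // [m%:R]natrM lnM ?posrE //.
  rewrite -!(mulr_natl (ln _)) -(mulr_natl (_ + _)) [(N * _)%:R]natrM => H.
  have Cm := @natr_bin2 R m; have Cq := @natr_bin2 R q.
  have mE : m%:R = N%:R * q%:R :> R by rewrite natrM.
  rewrite mE in H Cm.
  have Nq0 : 0 < N%:R * q%:R :> R by rewrite mulr_gt0.
  rewrite -(ler_pM2l Nq0) -subr_ge0 /delta.
  have -> : N%:R * q%:R * (2 * ln N%:R + 2 * ln A - a - ln s + 2 * ln q%:R) -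
     N%:R * q%:R * (q%:R * (- ln s - N%:R * a)) =
     2 * (N%:R * q%:R * (ln N%:R + ln q%:R) + N%:R * q%:R * ln A)
      + N%:R * (q%:R * (q%:R - 1)) * ln s
      + N%:R * q%:R * (N%:R * q%:R - 1) * a by ring.
  by rewrite -Cm -Cq; lra.
pose K := `|2 * ln N%:R + 2 * ln A - a - ln s|.
(* With [q = p^2], [2 ln q = 4 ln p < 4 p], while [p delta > K + 4] gives
   [q delta > p (K + 4) >= K + 4 p], against [main]. *)
pose p := (Num.truncn ((K + 4) / delta)).+1.
have pK : K + 4 < p%:R * delta by rewrite -ltr_pdivrMr // truncnS_gt.
have p1 : 1 <= p%:R :> R by rewrite ler1n.
have := main (p * p)%N isT; rewrite natrM [ln (p%:R * _)]lnM ?posrE ?ltr0n // => H.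
have lnp : ln (p%:R : R) < p%:R by rewrite ln_sublinear ?ltr0n.
have Kle : 2 * ln N%:R + 2 * ln A - a - ln s <= K by exact: ler_norm.
have K0 : 0 <= K by exact: normr_ge0.
have : p%:R * (K + 4) < p%:R * (p%:R * delta) by rewrite ltr_pM2l ?ltr0n.
have : K <= p%:R * K by rewrite ler_peMl.
rewrite mulrDr mulrA; lra.
Qed.

Lemma log_capacity_ge0 {R : realType} (e : set R) : 0 <= log_capacity e.
Proof. by rewrite /log_capacity fine_ge0 // expeR_ge0. Qed.

Lemma log_capacity_le {R : realType} (e : set R) (P : {poly R}) (s : R) (N : nat) :
  compact e -> P \is monic -> size P = N.+1 -> (0 < N)%N -> 0 < s ->
  (forall x, e x -> `|P.[x]| <= 2 * s) -> log_capacity e ^+ N <= s.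
Proof.
move=> ce mP sP N0 s0 eP.
have N0' : N%:R != 0 :> R by rewrite pnatr_eq0 -lt0n.
have -> : s = expR (ln s / N%:R) ^+ N.
  by rewrite -expRM_natl mulrC divfK // lnK // posrE.
apply: lerXn2r; rewrite ?nnegrE ?log_capacity_ge0 ?expR_ge0 //.
rewrite /log_capacity; set I := ereal_inf _.
have le : (expeR (- I) <= (expR (ln s / N%:R))%:E)%E.
  rewrite -[leRHS]/(expeR (ln s / N%:R)%:E) lee_expeR leeNl -EFinN.
  by apply: le_ereal_inf_tmp => _ [mu /= mue <-]; exact: energy_lower_bound eP mue.
(* By [le] the exponential is finite, so [fine] does not fall back on its default value. *)
rewrite -lee_fin fineK // ge0_fin_numE ?expeR_ge0 //.
exact: le_lt_trans le (ltry _).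
Qed.

(** * Sup norms of complex polynomials on a real set *)

Local Open Scope complex_scope.

Lemma Re_normcE {R : realType} (z : R[i]) : (complex.Re `|z|)%:C = `|z|.
Proof. by rewrite RRe_real // normr_real. Qed.

Lemma normc_real {R : realType} (x : R) : `|x%:C| = `|x|%:C.
Proof. by rewrite normc_def /= expr0n addr0 sqrtr_sqr. Qed.

(** A crude bound, which makes the supremum in [poly_norm] that of a bounded set. *)
Lemma Re_normc_horner_le {R : realType} (P : {poly R[i]}) (x D : R) : 1 <= D ->
  `|x| <= D -> complex.Re `|P.[x%:C]| <=
    \sum_(i < size P) complex.Re `|P`_i| * D ^+ (size P).
Proof.
move=> D1 xD; rewrite -lecR Re_normcE rmorph_sum horner_coef.
apply: le_trans (ler_norm_sum _ _ _) _; apply: ler_sum => i _.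
rewrite rmorphM /= Re_normcE normrM ler_wpM2l //.
rewrite normrX normc_real -rmorphXn lecR.
apply: (@le_trans _ _ (D ^+ i)).
  by apply: lerXn2r; rewrite ?nnegrE ?normr_ge0 ?(le_trans ler01 D1).
by rewrite ler_weXn2l // ltnW.
Qed.

Lemma le_poly_norm {R : realType} (e : set R) (P : {poly R[i]}) (x : R) :
  compact e -> e x -> complex.Re `|P.[x%:C]| <= poly_norm e P.
Proof.
move=> ce ex; have [D D1 eD] := compact_normr_le e ce.
apply: ub_le_sup; last by exists x.
exists (\sum_(i < size P) complex.Re `|P`_i| * D ^+ (size P)) => _ [y ey <-].
by apply: Re_normc_horner_le; rewrite ?eD.
Qed.

Lemma poly_norm_le {R : realType} (e : set R) (P : {poly R[i]}) (M : R) :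
  e !=set0 -> (forall x, e x -> complex.Re `|P.[x%:C]| <= M) -> poly_norm e P <= M.
Proof.
move=> [x ex] eM; apply: ge_sup; first by exists (complex.Re `|P.[x%:C]|); exists x.
by move=> _ [y ey <-]; exact: eM.
Qed.

(** On the real line this is the real part of [P], so its norm is no larger; it stays monic of the
    same degree when [P] is monic. Complex competitors thus reduce to real ones. *)
Definition Re_poly {R : realType} (P : {poly R[i]}) : {poly R} :=
  \poly_(i < size P) complex.Re P`_i.

Lemma Re_poly_monic {R : realType} (m : nat) (P : {poly R[i]}) :
  monic_deg m P -> Re_poly P \is monic /\ size (Re_poly P) = m.+1.
Proof.
move=> [/monicP mP sP]; have Pm : complex.Re P`_m = 1.
  by move: mP; rewrite /lead_coef sP => ->.
have sR : size (Re_poly P) = m.+1.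
  by rewrite /Re_poly sP size_poly_eq //= Pm oner_eq0.
by split=> //; rewrite monicE /lead_coef sR coef_poly sP ltnSn Pm.
Qed.

Lemma Re_poly_horner {R : realType} (P : {poly R[i]}) (x : R) :
  (Re_poly P).[x] = complex.Re P.[x%:C].
Proof.
have ReD : {morph @complex.Re R : z w / z + w} by move=> [? ?] [? ?].
rewrite horner_poly horner_coef (big_morph _ ReD (erefl _)) //.
apply: eq_bigr => i _; rewrite -rmorphXn /=.
by case: (P`_i) => u v /=; rewrite mulr0 subr0.
Qed.

Lemma Re_poly_norm_le {R : realType} (P : {poly R[i]}) (x : R) :
  `|(Re_poly P).[x]| <= complex.Re `|P.[x%:C]|.
Proof. by rewrite Re_poly_horner -lecR Re_normcE normc_ge_Re. Qed.

Lemma horner_map_real_complex {R : realType} (P : {poly R}) (x : R) :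
  complex.Re `|(map_poly (real_complex R) P).[x%:C]| = `|P.[x]|.
Proof. by rewrite horner_map normc_real. Qed.

Lemma map_real_complex_monic_deg {R : realType} (m : nat) (P : {poly R}) :
  P \is monic -> size P = m.+1 -> monic_deg m (map_poly (real_complex R) P).
Proof. by move=> mP sP; split; rewrite ?map_monic ?size_map_poly. Qed.

(* Schiefermayer's inequality. *)
Lemma poly_norm_ge_capacity {R : realType} (e : set R) (m : nat) (P : {poly R[i]}) :
  compact e -> e !=set0 -> (0 < m)%N -> monic_deg m P ->
  2 * log_capacity e ^+ m <= poly_norm e P.
Proof.
move=> ce [x0 ex0] m0 mP; have [mR sR] := Re_poly_monic m P mP.
have P0 : 0 <= poly_norm e P.
  apply: le_trans (le_poly_norm e P x0 ce ex0).
  exact: le_trans (normr_ge0 _) (Re_poly_norm_le P x0).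
(* [log_capacity_le] asks for [s > 0], and the norm is only known to be nonnegative. *)
apply/ler_addgt0Pr => eps eps0.
suff : log_capacity e ^+ m <= (poly_norm e P + eps) / 2 by lra.
apply: (log_capacity_le e (Re_poly P) _ m ce mR sR m0); first by lra.
move=> x ex; rewrite mulrC divfK //.
apply: le_trans (Re_poly_norm_le P x) _.
by apply: le_trans (le_poly_norm e P x ce ex) _; lra.
Qed.

(** * Existence of Chebyshev polynomials *)

Lemma infinite_set_seq {R : realType} (e : set R) : infinite_set e ->
  exists2 x : nat -> R, injective x & forall i, e (x i).
Proof.
move=> /infiniteP/pcard_leP[f]; exists f; last by move=> i; exact: (@funS _ _ _ _ f i I).
by move=> i j; apply: (@inj _ _ _ f); rewrite inE.
Qed.

Lemma coord_norm_le {R : realType} (n : nat) (w : 'rV[R]_n) (j : 'I_n) :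
  `|w 0 j| <= `|w|.
Proof.
rewrite [leRHS]mx_normrE.
exact: (le_bigmax _ (fun ij : 'I_1 * 'I_n => `|w ij.1 ij.2|) (0, j)).
Qed.

Lemma rVpoly_horner {R : realType} (n : nat) (c : 'rV[R]_n) (y : R) :
  (rVpoly c).[y] = \sum_(k < n) c 0 k * y ^+ k.
Proof.
rewrite (horner_coef_wide _ (size_poly _ _)).
by apply: eq_bigr => k _; rewrite coef_rVpoly_ord.
Qed.

Lemma XnD_rVpoly_monic {R : realType} (n : nat) (c : 'rV[R]_n) :
  'X^n + rVpoly c \is monic /\ size ('X^n + rVpoly c) = n.+1.
Proof.
have lt : (size (rVpoly c) < size ('X^n : {poly R}))%N.
  by rewrite size_polyXn ltnS size_poly.
split; last by rewrite size_polyDl // size_polyXn.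
by rewrite monicE lead_coefDl // lead_coefXn.
Qed.

(** The factor of [|w|] is the Lipschitz constant that makes the norm continuous in the parameters
    below. *)
Lemma mulmx_rVpoly_norm_le {R : realType} (n : nat) (W : 'M[R]_n) (w : 'rV[R]_n) (y D : R) :
  `|y| <= D -> `|(rVpoly (w *m W)).[y]| <=
    `|w| * \sum_(k < n) \sum_(j < n) `|W j k| * D ^+ k.
Proof.
move=> yD; have D0 := le_trans (normr_ge0 y) yD.
rewrite rVpoly_horner mulr_sumr.
apply: le_trans (ler_norm_sum _ _ _) _; apply: ler_sum => k _.
rewrite mxE mulr_suml mulr_sumr.
apply: le_trans (ler_norm_sum _ _ _) _; apply: ler_sum => j _.
rewrite !normrM -mulrA; apply: ler_pM; rewrite ?mulr_ge0 ?coord_norm_le //.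
by apply: ler_pM; rewrite // normrX; apply: lerXn2r; rewrite ?nnegrE.
Qed.

(* Monic polynomials are parametrized by the differences of their values at n
   points of e with those of X^n; a polynomial outside the box of size M has a
   larger norm than X^n. *)
Lemma exists_chebyshev {R : realType} (e : set R) (n : nat) :
  compact e -> infinite_set e -> exists P, is_chebyshev e n P.
Proof.
move=> ce /infinite_set_seq[x xinj ex].
have e0 : e !=set0 by exists (x 0%N).
have [D D1 eD] := compact_normr_le e ce.
pose V : 'M[R]_n := Vandermonde n (\row_i x i).
have Vu : V \in unitmx.
  rewrite unitmxE unitfE det_Vandermonde; apply/prodf_neq0 => i _.
  apply/prodf_neq0 => j ij; rewrite !mxE subr_eq0; apply/eqP => /xinj ji.
  by rewrite ji ltnn in ij.
pose P (w : 'rV[R]_n) := 'X^n + rVpoly (w *m invmx V).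
pose toC := map_poly (real_complex R).
pose F w := poly_norm e (toC (P w)).
pose Lam := \sum_(k < n) \sum_(j < n) `|invmx V j k| * D ^+ k.
have Lam0 : 0 <= Lam.
  apply: sumr_ge0 => k _; apply: sumr_ge0 => j _.
  by rewrite mulr_ge0 // exprn_ge0 // (le_trans ler01).
have FP w y : e y -> `|(P w).[y]| <= F w.
  by move=> ey; rewrite -horner_map_real_complex; exact: le_poly_norm.
have FL w w' : F w <= F w' + `|w - w'| * Lam.
  apply: poly_norm_le => // y ey; rewrite horner_map_real_complex.
  have -> : P w = P w' + rVpoly ((w - w') *m invmx V).
    by rewrite /P mulmxBl linearB /= -addrA; congr (_ + _); rewrite addrC subrK.
  rewrite hornerD; apply: le_trans (ler_normD _ _) _.
  by apply: lerD; [exact: FP | apply: mulmx_rVpoly_norm_le; exact: eD].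
have Fc : continuous F.
  move=> w; apply/(cvgrPdist_le (FF := nbhs_filter w)) => eps eps0.
  have L0 : 0 < eps / (Lam + 1) by rewrite divr_gt0 // ltr_wpDl.
  near=> w'.
  have ww : `|w - w'| <= eps / (Lam + 1) by near: w'; exact: cvgr_dist_le.
  have le : `|w - w'| * Lam <= eps.
    apply: (@le_trans _ _ (eps / (Lam + 1) * (Lam + 1))); last first.
      by rewrite divfK // gt_eqF // ltr_wpDl.
    by apply: ler_pM => //; rewrite lerDl.
  have := FL w w'; have := FL w' w; rewrite (distrC w' w) ler_norml; lra.
(* [F 0] is the norm of [X^n]. A coordinate above [M] forces a value at some [x i] of size more than
   [M - D^n = F 0]. *)
pose M := D ^+ n + F 0.
have M0 : 0 <= M.
  apply: addr_ge0; last exact: (le_trans _ (FP 0 _ (ex 0%N))).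
  by rewrite exprn_ge0 // (le_trans ler01 D1).
have cB : compact [set w : 'rV[R]_n | forall i, `[- M, M]%classic (w ord0 i)].
  by apply: (@rV_compact R n (fun=> `[- M, M]%classic)) => i; exact: segment_compact.
have [|w0 w0B w0min] := EVT_min_rV _ cB (continuous_subspaceT Fc).
  by exists 0 => i /=; rewrite mxE in_itv /= oppr_le0 M0.
exists (toC (P w0)); split.
  by have [mP sP] := XnD_rVpoly_monic n (w0 *m invmx V);
    exact: map_real_complex_monic_deg.
move=> Q mQ; have [mR sR] := Re_poly_monic n Q mQ.
set q := Re_poly Q in mR sR.
have qQ y : e y -> `|q.[y]| <= poly_norm e Q.
  by move=> ey; apply: le_trans (Re_poly_norm_le Q y) (le_poly_norm e Q y ce ey).
pose c : 'rV[R]_n := poly_rV (q - 'X^n).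
have qE : q = 'X^n + rVpoly c.
  rewrite /c poly_rV_K; first by rewrite addrC subrK.
  apply/leq_sizeP => j; rewrite leq_eqVlt coefB coefXn => /orP[/eqP <-|nj].
    by move: (monicP mR); rewrite /lead_coef sR eqxx => ->; rewrite subrr.
  by rewrite nth_default ?sR // gtn_eqF // subr0.
pose w := c *m V.
have Pw : P w = q by rewrite /P /w mulmxK.
have wE i : w 0 i = q.[x i] - x i ^+ n.
  rewrite qE hornerD hornerXn addrC addKr rVpoly_horner mxE.
  by apply: eq_bigr => k _; rewrite !mxE.
have [wB|/existsNP[i wi]] := pselect (forall i, `|w 0 i| <= M).
  apply: (@le_trans _ _ (F w)).
    by apply: w0min; rewrite inE => i /=; rewrite in_itv /= -ler_norml.
  by apply: poly_norm_le => // y ey; rewrite horner_map_real_complex Pw; exact: qQ.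
apply: (@le_trans _ _ (F 0)).
  by apply: w0min; rewrite inE => j /=; rewrite mxE in_itv /= oppr_le0 M0.
apply: (le_trans _ (qQ _ (ex i))).
move/negP: wi; rewrite -ltNge wE => wi.
have : `|x i ^+ n| <= D ^+ n.
  by rewrite normrX; apply: lerXn2r; rewrite ?nnegrE ?(le_trans ler01 D1) // eD.
have := ler_normB q.[x i] (x i ^+ n); move: wi; rewrite /M; lra.
Unshelve. all: by end_near.
Qed.

Local Close Scope complex_scope.

Theorem theorem1p4 (R : realType) (e : set R)
    (e_compact : compact e) (e_infinite : ~ finite_set e)
    (n : nat) (n_ge1 : (1 <= n)%N)
    (tn_eq : poly_norm e (chebyshev_poly e n) = 2 * log_capacity e ^+ n) :
  forall k : nat, (1 <= k)%N ->
    poly_norm e (chebyshev_poly e (n * k)) = 2 * log_capacity e ^+ (n * k).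
Proof.
move=> k k1.
have e0 : e !=set0 by have [x _ ex] := infinite_set_seq e e_infinite; exists (x 0%N).
(* Existence of a minimizer ensures that [xget] does not return 0. *)
have chebP m : is_chebyshev e m (chebyshev_poly e m).
  have [P HP] := exists_chebyshev e m e_compact e_infinite.
  exact: (xgetPex 0 (ex_intro _ P HP)).
have nk0 : (0 < n * k)%N by rewrite muln_gt0 n_ge1.
have [mT _] := chebP n; have [mTk minTk] := chebP (n * k)%N.
apply/eqP; rewrite eq_le poly_norm_ge_capacity // andbT.
set s := log_capacity e ^+ n in tn_eq.
set T := chebyshev_poly e n in tn_eq mT.
have s0 : 0 <= s by rewrite exprn_ge0 // log_capacity_ge0.
have [mp sp] := Re_poly_monic n T mT.
(* The hypothesis gives [|Re T| <= 2 s] on [e], so this competitor of degree [n k] has norm at most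
   [2 s^k], with [s^k] the power [n k] of the capacity. *)
have [md sd] := dickson_monic_size (s ^+ 2) (Re_poly T) n k mp sp n_ge1 k1.
apply: le_trans (minTk _ (map_real_complex_monic_deg _ _ md sd)) _.
apply: poly_norm_le => // x ex; rewrite horner_map_real_complex exprM.
apply: dickson_norm_le => //; rewrite -tn_eq.
exact: le_trans (Re_poly_norm_le T x) (le_poly_norm e T x e_compact ex).
Qed.
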